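(* Let $T$ be the Thompson group $T$, with its standard generators $A,B,C$, and let $L=APA^{-1}\in T$, where $R=A^{-1}CB$ and $P=A^{-1}RB$. Then $T$ is generated by $L$ and $C$, and, with the notation $I=LCL$, it has the presentation $$T=\langle L,C\mid I=LCL,\ C^3=I^4=L^5=(CIL)^7=1,\ I^2C=CI^2\rangle .$$
   Context: The standard presentation of the Thompson group $T$ has generators $A,B,C$; with the notations $R=A^{-1}CB$, $X_2=A^{-1}BA$, $P=A^{-1}RB$, its relations are: $R=B^{-1}C$; $RX_2=BP$; $CA=R^2$; $C^3=1$; $BA^{-1}$ commutes with $X_2$; $BA^{-1}$ commutes with $A^{-1}X_2A$. In the presentation of the claim, $I$ is only an abbreviation for the word $LCL$. *)

(* Defs.v *)
(* MathComp. T is infinite, hence a groupType rather than a finGroupType. *)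
From HB Require Import structures.
From mathcomp Require Import all_boot.

Set Implicit Arguments.
Unset Strict Implicit.
Unset Printing Implicit Defensive.

Local Open Scope group_scope.

(* Words are formal group expressions. They only form a baseGroupType (the
   operations, without the group laws); the laws are imposed by [derivable]
   below, so that word X modulo [derivable] by no relation at all is the free
   group on X. *)
Inductive word (X : Type) : Type :=
| Gen of X
| Word1
| WordMul of word X & word X
| WordInv of word X.
Arguments Word1 {X}.

HB.instance Definition _ (X : Type) := hasMul.Build (word X) (@WordMul X).
HB.instance Definition _ (X : Type) := hasOne.Build (word X) (@Word1 X).
HB.instance Definition _ (X : Type) := hasInv.Build (word X) (@WordInv X).

Fixpoint eval (X : Type) (G : groupType) (g : X -> G) (w : word X) : G :=
  match w with
  | Gen x => g x
  | Word1 => 1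
  | WordMul u v => eval g u * eval g v
  | WordInv u => (eval g u)^-1
  end.

(* The least congruence on words containing the group laws and the pairs of
   rel: word X modulo [derivable rel] is < X | u = v for rel u v >, the
   quotient of the free group on X by the normal closure of the u * v^-1. *)
Inductive derivable (X : Type) (rel : word X -> word X -> Prop) :
  word X -> word X -> Prop :=
| der_rel u v : rel u v -> derivable rel u v
| der_refl u : derivable rel u u
| der_sym u v : derivable rel u v -> derivable rel v u
| der_trans u v w : derivable rel u v -> derivable rel v w -> derivable rel u w
| der_mul u u' v v' : derivable rel u u' -> derivable rel v v' ->
    derivable rel (u * v) (u' * v')
| der_inv u u' : derivable rel u u' -> derivable rel u^-1 u'^-1
| der_mulA u v w : derivable rel (u * (v * w)) ((u * v) * w)
| der_mul1 u : derivable rel (1 * u) u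
| der_mulV u : derivable rel (u^-1 * u) 1.

Definition generates (X : Type) (G : groupType) (g : X -> G) : Prop :=
  forall x : G, exists w : word X, x = eval g w.

(* G = < X | rel > via g : X -> G, i.e. evaluation at g induces an isomorphism
   from the presented group onto G. *)
Definition has_presentation (X : Type) (G : groupType) (g : X -> G)
    (rel : word X -> word X -> Prop) : Prop :=
  generates g /\ forall u v : word X, eval g u = eval g v <-> derivable rel u v.

(* The abbreviations R, X_2, P, used both for words and in groups. *)
Definition thompsonR (G : baseGroupType) (A B C : G) : G := A^-1 * C * B.
Definition thompsonX2 (G : baseGroupType) (A B : G) : G := A^-1 * B * A.
Definition thompsonP (G : baseGroupType) (A B C : G) : G :=
  A^-1 * thompsonR A B C * B.

Inductive genABC : Type := genA | genB | genC.

Definition valABC (G : Type) (A B C : G) (x : genABC) : G :=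
  match x with genA => A | genB => B | genC => C end.

Inductive thompson_rel : word genABC -> word genABC -> Prop :=
| thompson_rel1 (A := Gen genA) (B := Gen genB) (C := Gen genC) :
    thompson_rel (thompsonR A B C) (B^-1 * C)
| thompson_rel2 (A := Gen genA) (B := Gen genB) (C := Gen genC) :
    thompson_rel (thompsonR A B C * thompsonX2 A B) (B * thompsonP A B C)
| thompson_rel3 (A := Gen genA) (B := Gen genB) (C := Gen genC) :
    thompson_rel (C * A) (thompsonR A B C ^+ 2)
| thompson_rel4 (C := Gen genC) :
    thompson_rel (C ^+ 3) 1
| thompson_rel5 (A := Gen genA) (B := Gen genB) :
    thompson_rel ((B * A^-1) * thompsonX2 A B) (thompsonX2 A B * (B * A^-1))
| thompson_rel6 (A := Gen genA) (B := Gen genB)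
    (X3 := A^-1 * thompsonX2 A B * A) :
    thompson_rel ((B * A^-1) * X3) (X3 * (B * A^-1)).

(* T is Thompson's group T with standard generators A, B, C. *)
Definition is_ThompsonT (T : groupType) (A B C : T) : Prop :=
  has_presentation (valABC A B C) thompson_rel.

Inductive genLC : Type := genL | genC'.

Definition valLC (G : Type) (L C : G) (x : genLC) : G :=
  match x with genL => L | genC' => C end.

Definition wordL : word genLC := Gen genL.
Definition wordC : word genLC := Gen genC'.
Definition wordI : word genLC := wordL * wordC * wordL.

Inductive LC_rel : word genLC -> word genLC -> Prop :=
| LC_rel1 : LC_rel (wordC ^+ 3) 1
| LC_rel2 : LC_rel (wordI ^+ 4) 1
| LC_rel3 : LC_rel (wordL ^+ 5) 1
| LC_rel4 : LC_rel ((wordC * wordI * wordL) ^+ 7) 1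
| LC_rel5 : LC_rel (wordI ^+ 2 * wordC) (wordC * wordI ^+ 2).

(* Main.v *)
From HB Require Import structures.
Require Import Defs.
From mathcomp Require Import all_boot.
From mathcomp Require Import generic_quotient boolp.

Local Open Scope group_scope.

(** Both presentations describe the same group because, in every group at all,
    a triple A, B, C satisfies Thompson's relations, with L = A P A^-1, exactly
    when the pair L, C satisfies the relations of the claim and A = L^2 C L^2,
    B = C^-1 L^2. By von Dyck's theorem (completeness of [derivable] for
    groups, [derivable_complete]) such a correspondence of tuples, natural in
    the group, transports presentations ([change_presentation]).

    Write I = L C L and i = I^2. Thompson's relations other than the two
    commutations say that R = B^-1 C satisfies R^4 = (R C)^5 = 1, and then
    L = (R C)^2 and L^2 = C^-1 R^-1; this is the part C^3 = I^4 = L^5 = 1 of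
    the claim, I being a conjugate of R^-1. The two commutations are dealt with
    one after the other in the presence of these relations, which make i an
    involution.

    - B A^-1 commutes with X_2 if and only if i commutes with C
      ([commute_X2_iff]): after conjugation the two elements become
      L^-1 i C^-1 and L^-1 I^-1, whose products in the two orders are
      L^-1 i L i and L^-1 i L (C i C^-1).

    - If i commutes with C, then B A^-1 commutes with A^-1 X_2 A if and only if
      (C I L)^7 = 1 ([commute_X3_iff]). Put j = i C and h = i L. The identity
      j^-1 L^-2 = h^2 C ([pentagon_move]) together with C j = j^-1 and
      C j^-1 = i lets h^7 C be unrolled, two factors h at a time, into
      C w, where w = j^-1 L j^-1 L^-2 j L^-2 j L^-2 ([h7_unrolled]). Up to
      conjugation w is the commutator of the two elements that have to commute
      ([commute_j_iff]), and h^-1 is conjugate to C I L.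

    Geometrically C, I, L, j and h rotate a triangle, a square, a pentagon, a
    hexagon and a heptagon, and the two commutations say that flips of disjoint
    diagonals of a hexagon, respectively of a heptagon, commute. *)

(** * Von Dyck's theorem and change of presentation *)

Definition respects {X : Type} (rel : word X -> word X -> Prop)
    {G : groupType} (g : X -> G) : Prop :=
  forall u v, rel u v -> eval g u = eval g v.

Lemma derivable_sound {X : Type} (rel : word X -> word X -> Prop)
    {G : groupType} (g : X -> G) (u v : word X) :
  respects rel g -> derivable rel u v -> eval g u = eval g v.
Proof.
move=> g_rel; elim=> {u v} //=.
- by move=> u v w _ -> _ ->.
- by move=> u u' v v' _ -> _ ->.
- by move=> u u' _ ->.
- by move=> u v w; rewrite mulgA.
- by move=> u; rewrite mul1g.
- by move=> u; rewrite mulVg.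
Qed.

(** Groups carry a choice structure, which words get from classical logic. *)
HB.instance Definition _ (X : Type) := gen_eqMixin (word X).
HB.instance Definition _ (X : Type) := gen_choiceMixin (word X).

Section PresentedGroup.
Local Open Scope quotient_scope.
Variables (X : Type) (rel : word X -> word X -> Prop).

Definition derivableb (u v : word X) : bool := `[< derivable rel u v >].

Lemma derivableb_refl : reflexive derivableb.
Proof. by move=> u; apply/asboolP; apply: der_refl. Qed.

Lemma derivableb_sym : symmetric derivableb.
Proof. by move=> u v; apply/asboolP/asboolP => /der_sym. Qed.

Lemma derivableb_trans : transitive derivableb.
Proof.
by move=> v u w /asboolP uv /asboolP vw; apply/asboolP; apply: der_trans vw.
Qed.

Canonical derivable_equiv :=
  EquivRel derivableb derivableb_refl derivableb_sym derivableb_trans.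

Definition presented : Type := {eq_quot derivable_equiv}.
HB.instance Definition _ := Choice.on presented.

Definition class (u : word X) : presented := \pi_{eq_quot derivable_equiv} u.

Lemma class_eq (u v : word X) : class u = class v <-> derivable rel u v.
Proof. by split=> [/eqmodP/asboolP | uv]; last apply/eqmodP/asboolP. Qed.

Definition word_of (x : presented) : word X :=
  repr (x : {eq_quot derivable_equiv}).

Lemma word_ofK (x : presented) : class (word_of x) = x.
Proof. exact: reprK. Qed.

Lemma word_of_class (u : word X) : derivable rel (word_of (class u)) u.
Proof. by apply/class_eq; rewrite word_ofK. Qed.

Definition presented_mul (x y : presented) := class (word_of x * word_of y).
Definition presented_inv (x : presented) := class (word_of x)^-1.

Lemma class_mul (u v : word X) :
  presented_mul (class u) (class v) = class (u * v).
Proof. by apply/class_eq; apply: der_mul; apply: word_of_class. Qed.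

Lemma class_inv (u : word X) : presented_inv (class u) = class u^-1.
Proof. by apply/class_eq; apply: der_inv; apply: word_of_class. Qed.

Lemma presented_mulA : associative presented_mul.
Proof.
move=> x y z; rewrite -(word_ofK x) -(word_ofK y) -(word_ofK z) !class_mul.
by apply/class_eq; apply: der_mulA.
Qed.

Lemma presented_mul1 : left_id (class 1) presented_mul.
Proof.
by move=> x; rewrite -(word_ofK x) class_mul; apply/class_eq; apply: der_mul1.
Qed.

Lemma presented_mulV : left_inverse (class 1) presented_inv presented_mul.
Proof.
move=> x; rewrite -(word_ofK x) class_inv class_mul.
by apply/class_eq; apply: der_mulV.
Qed.

Lemma presented_inv_right : right_inverse (class 1) presented_inv presented_mul.
Proof.
move=> x; set y := presented_inv x.
rewrite -[LHS]presented_mul1 -[X in presented_mul X _](presented_mulV y).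
rewrite -presented_mulA (presented_mulA y) presented_mulV.
by rewrite presented_mul1 presented_mulV.
Qed.

Lemma presented_mul1_right : right_id (class 1) presented_mul.
Proof.
move=> x; rewrite -(presented_mulV x) presented_mulA presented_inv_right.
exact: presented_mul1.
Qed.

HB.instance Definition _ := isGroup.Build presented
  presented_mulA presented_mul1 presented_mul1_right
  presented_mulV presented_inv_right.

Lemma eval_class (u : word X) : eval (fun x => class (Gen x)) u = class u.
Proof.
by elim: u => [//|//|u /= -> v ->|u /= ->]; [apply: class_mul|apply: class_inv].
Qed.

Lemma class_respects : respects rel (fun x => class (Gen x)).
Proof. by move=> u v uv; rewrite !eval_class; apply/class_eq/der_rel. Qed.

End PresentedGroup.

(** The presented group itself is a group in which only the derivable
    equations hold between the generators. *)
Lemma derivable_complete {X : Type} (rel : word X -> word X -> Prop)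
    (u v : word X) :
  (forall (G : groupType) (g : X -> G), respects rel g -> eval g u = eval g v) ->
  derivable rel u v.
Proof.
by move=> /(_ _ _ (class_respects _ rel)); rewrite !eval_class => /class_eq.
Qed.

Fixpoint subst {X Y : Type} (s : X -> word Y) (w : word X) : word Y :=
  match w with
  | Gen x => s x
  | Word1 => 1
  | WordMul u v => subst s u * subst s v
  | WordInv u => (subst s u)^-1
  end.

Lemma eval_subst {X Y : Type} {G : groupType} (g : X -> G) (h : Y -> G)
    (s : X -> word Y) :
  (forall x, g x = eval h (s x)) -> forall w, eval g w = eval h (subst s w).
Proof. by move=> gh; elim=> //= [u -> v ->|u ->]. Qed.

(** The two hypotheses say that s and t give, in every group, inverse
    bijections between the families satisfying rel and those satisfying rel'.
    An equation between words in h holds in T exactly when its translation by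
    t is derivable from rel; any family b satisfying rel' is the translation of
    a family satisfying rel, so the equation holds for b, and completeness
    applies. *)
Lemma change_presentation {X Y : Type} (rel : word X -> word X -> Prop)
    (rel' : word Y -> word Y -> Prop) (s : X -> word Y) (t : Y -> word X)
    (T : groupType) (g : X -> T) (h : Y -> T) :
  (forall (G : groupType) (a : X -> G) (b : Y -> G),
    respects rel a -> (forall y, b y = eval a (t y)) ->
    respects rel' b /\ forall x, a x = eval b (s x)) ->
  (forall (G : groupType) (b : Y -> G) (a : X -> G),
    respects rel' b -> (forall x, a x = eval b (s x)) ->
    respects rel a /\ forall y, b y = eval a (t y)) ->
  has_presentation g rel -> (forall y, h y = eval g (t y)) ->
  has_presentation h rel'.
Proof.
move=> fwd bwd [g_gen g_rel] h_def.
have [|h_rel g_def] := fwd T g h _ h_def.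
  by move=> u v uv; apply/g_rel/der_rel.
split=> [x | u v].
  by have [w ->] := g_gen x; exists (subst s w); apply: eval_subst.
split=> [uv|]; last exact: derivable_sound.
apply: derivable_complete => G b b_rel.
have [|a_rel b_def] := bwd G b (fun x => eval b (s x)) b_rel; first by [].
rewrite !(eval_subst _ _ _ b_def); apply: derivable_sound a_rel _.
by apply/g_rel; rewrite -!(eval_subst _ _ _ h_def).
Qed.

(** * Triangle, square and pentagon rotations *)

Lemma commuteJ {G : groupType} (x y z : G) :
  commute (x ^ z) (y ^ z) <-> commute x y.
Proof. by rewrite /commute -!conjMg; split=> [/conjg_inj|->]. Qed.

Lemma expgJ_eq1 {G : groupType} (x y z : G) n :
  x ^ z = y -> x ^+ n = 1 <-> y ^+ n = 1.
Proof.
move=> <-; rewrite -conjXg; split=> [->|/eqP]; first exact: conj1g.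
by rewrite conjg_eq1 => /eqP.
Qed.

(** With a prefix z, a relation that is itself stated with a prefix rewrites
    at every place of a product bracketed to the left, including the first. *)
Lemma mulg_ext {G : groupType} (u v : G) : (forall z, z * u = z * v) -> u = v.
Proof. by move=> /(_ 1); rewrite !mul1g. Qed.

Definition A_of_LC {G : groupType} (L C : G) : G := L ^+ 2 * C * L ^+ 2.
Definition B_of_LC {G : groupType} (L C : G) : G := C^-1 * L ^+ 2.

Section PolygonRotations.
Variables (G : groupType) (L C : G).
Hypotheses (C3 : C ^+ 3 = 1) (L5 : L ^+ 5 = 1) (I4 : (L * C * L) ^+ 4 = 1).

Local Notation A := (A_of_LC L C).
Local Notation B := (B_of_LC L C).

(* I, i, j, h are variables tied by equations, not definitions: the
   normalization of products must treat them as letters. *)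
Variables (I i j h : G).
Hypotheses (IE : I = L * C * L) (iE : i = I ^+ 2).
Hypotheses (jE : j = i * C) (hE : h = i * L).

Lemma CC z : z * C * C = z * C^-1.
Proof. by rewrite -mulgA; congr (_ * _); apply/esym/mulg1_eq; rewrite -C3. Qed.

Lemma CVCV z : z * C^-1 * C^-1 = z * C.
Proof. by rewrite -(mulgVK C z) CC !mulgK. Qed.

Lemma LLL z : z * L * L * L = z * L^-1 * L^-1.
Proof.
apply: (mulIg (L ^+ 2)).
by rewrite -[RHS]mulg1 -[in RHS]L5 !expgS expg0 !gnorm.
Qed.

Lemma LVLVLV z : z * L^-1 * L^-1 * L^-1 = z * L * L.
Proof. by rewrite -[z in RHS](mulgVK L) -(LLL (z / L)) !gnorm. Qed.

Definition CL_rules := (CC, CVCV, LLL, LVLVLV).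

Lemma iV : i^-1 = i.
Proof. by apply: mulg1_eq; rewrite iE IE -expgnDr. Qed.

Lemma I3 : I ^+ 3 = I^-1.
Proof. by apply/esym/mulg1_eq; rewrite -expgS IE. Qed.

Lemma iV_word z : z * C^-1 * L^-1 * L^-1 * C^-1 * L^-1 = z * L * i.
Proof. by rewrite -iV iE IE expg2 !gnorm. Qed.

(** * The first commutation and the hexagon *)

Lemma BA_conj : (B * A^-1) ^ (L^-1 * L^-1 * C^-1) = L^-1 * i * C^-1.
Proof.
apply: mulg_ext => z.
by rewrite conjgE iE IE /A_of_LC /B_of_LC !expg2 !gnorm ?CL_rules ?gnorm.
Qed.

Lemma X2_conj :
  thompsonX2 A B ^ (L^-1 * L^-1 * C^-1) = L^-1 * L^-1 * C^-1 * L^-1.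
Proof.
apply: mulg_ext => z; rewrite conjgE /thompsonX2 /A_of_LC /B_of_LC.
by rewrite !expg2 !gnorm ?CL_rules ?gnorm ?CL_rules ?gnorm.
Qed.

(** Since i is an involution, the word C^-1 L^-2 C^-1 L^-1 equals L i; it occurs
    in the product of the two conjugates above in one order, and in the other
    order L^-2 C^-1 L^-2 equals L^-1 i L C. The products are thus L^-1 i L i and
    L^-1 i L (C i C^-1). *)
Lemma commute_X2_iff : commute (B * A^-1) (thompsonX2 A B) <-> commute i C.
Proof.
apply: (iff_trans (iff_sym (commuteJ _ _ (L^-1 * L^-1 * C^-1)))).
rewrite BA_conj X2_conj /commute.
have -> : L^-1 * i * C^-1 * (L^-1 * L^-1 * C^-1 * L^-1) = L^-1 * i * L * i.
  by rewrite !mulgA iV_word.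
have -> : L^-1 * L^-1 * C^-1 * L^-1 * (L^-1 * i * C^-1)
          = L^-1 * i * L * (C * i * C^-1).
  by rewrite -[X in L^-1 * X * L]iV {2}iE IE expg2 !gnorm.
split=> [/mulgI e | iC]; first by rewrite {1}e mulgVK.
by rewrite -iC mulgK.
Qed.

(** * The second commutation and the heptagon *)

Lemma X3_conj :
  (A^-1 * thompsonX2 A B * A) ^ (L^-1 * L^-1 * C^-1 * L) = L * i * C.
Proof.
apply: mulg_ext => z; rewrite conjgE /thompsonX2 /A_of_LC /B_of_LC.
rewrite !expg2 !gnorm ?CL_rules ?gnorm ?CL_rules ?gnorm.
by rewrite ?iV_word ?gnorm.
Qed.

Hypothesis iC : commute i C.

Lemma jV : j^-1 = i * C^-1.
Proof. by rewrite jE invgM iV; apply/esym/commuteV. Qed.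

(** Both sides are i L I^-1 L^-1: the left one because C^-1 L^-1 = L I^-1, the
    right one because L C = I L^-1 and i I = I^3 = I^-1. *)
Lemma pentagon_move : j^-1 * L^-1 * L^-1 = h * h * C.
Proof.
have -> : j^-1 * L^-1 * L^-1 = i * L * I^-1 * L^-1.
  by rewrite jV IE !gnorm.
by rewrite -I3 hE iE IE !expgS !expg0 !gnorm.
Qed.

(** Read from the left, the right-hand side starts with C j^-1 L = i L = h; then
    each factor j^-1 L^-2 becomes h^2 C by [pentagon_move], and this C turns the
    following j into j^-1, which lets the next such factor appear. *)
Lemma h7_unrolled :
  h ^+ 7 * C = C * (j^-1 * L * j^-1 * L^-1 * L^-1 * j * L^-1 * L^-1 * j
                     * L^-1 * L^-1).
Proof.
have hhC z : z * h * h * C = z * j^-1 * L^-1 * L^-1.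
  by rewrite -!mulgA; congr (_ * _); rewrite !mulgA pentagon_move.
have Cj z : z * C * j = z * j^-1.
  by rewrite jV jE iC (commuteV iC) !mulgA CC.
have CjV : C * j^-1 = i by rewrite jV mulgA -iC mulgK.
rewrite !mulgA CjV -hE -hhC Cj -hhC Cj -hhC.
by rewrite !expgS expg0 !gnorm.
Qed.

(** As L^3 = L^-2, the word on the right is a conjugate of the commutator of the
    two elements on the left. *)
Lemma commute_j_iff :
  commute (L^-1 * j * L * L) (L * j) <->
  j^-1 * L * j^-1 * L^-1 * L^-1 * j * L^-1 * L^-1 * j * L^-1 * L^-1 = 1.
Proof.
have -> : j^-1 * L * j^-1 * L^-1 * L^-1 * j * L^-1 * L^-1 * j * L^-1 * L^-1
          = [~ L^-1 * j * L * L, L * j] ^ (L^-1 * L^-1).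
  apply: mulg_ext => z.
  by rewrite conjgE commgEl conjgE !gnorm ?CL_rules ?gnorm.
split=> [/commgP/eqP -> | /eqP]; first exact: conj1g.
by rewrite conjg_eq1 => /commgP.
Qed.

Lemma CIL_conj : C * I * L = h^-1 ^ (i * C^-1).
Proof.
have -> : h^-1 ^ (i * C^-1) = C * i^-1 * L^-1 * C^-1.
  by rewrite conjgE hE !gnorm.
by rewrite iV iE IE !gnorm.
Qed.

Lemma commute_X3_iff :
  commute (B * A^-1) (A^-1 * thompsonX2 A B * A) <-> (C * I * L) ^+ 7 = 1.
Proof.
apply: (iff_trans (iff_sym (commuteJ _ _ (L^-1 * L^-1 * C^-1 * L)))).
have -> : (B * A^-1) ^ (L^-1 * L^-1 * C^-1 * L) = (L^-1 * j * L * L)^-1.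
  by rewrite conjgM BA_conj conjgE !invgM jV !gnorm.
rewrite X3_conj -(mulgA L) -jE CIL_conj -conjXg.
split=> [/commute_sym/commuteV/commute_sym|/eqP].
  rewrite invgK => /commute_j_iff w1.
  have := h7_unrolled; rewrite w1 mulg1 -[RHS]mul1g => /mulIg.
  by rewrite expVgn => ->; rewrite invg1 conj1g.
rewrite conjg_eq1 expVgn invg_eq1 => /eqP h7.
apply/commute_sym/commuteV/commute_sym/commute_j_iff.
by apply: (mulgI C); rewrite -h7_unrolled h7 mul1g mulg1.
Qed.

End PolygonRotations.

(** * The two systems of relations in an arbitrary group *)

Definition thompson_relations {G : groupType} (A B C : G) : Prop :=
  [/\ thompsonR A B C = B^-1 * C,
      thompsonR A B C * thompsonX2 A B = B * thompsonP A B C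
    & C * A = thompsonR A B C ^+ 2] /\
  [/\ C ^+ 3 = 1, commute (B * A^-1) (thompsonX2 A B)
    & commute (B * A^-1) (A^-1 * thompsonX2 A B * A)].

Definition LC_relations {G : groupType} (L C : G) : Prop :=
  [/\ C ^+ 3 = 1, (L * C * L) ^+ 4 = 1, L ^+ 5 = 1,
      (C * (L * C * L) * L) ^+ 7 = 1
    & commute ((L * C * L) ^+ 2) C].

(** With R = L^-2 C^-1, which is conjugate to I^-1, the relations R X_2 = B P
    and C A = R^2 both reduce to R^4 = 1, in the form R^2 = R^-2 of [square]. *)
Lemma LC_to_thompson {G : groupType} (L C : G) :
  LC_relations L C ->
  thompson_relations (A_of_LC L C) (B_of_LC L C) C /\
  L = A_of_LC L C * thompsonP (A_of_LC L C) (B_of_LC L C) C * (A_of_LC L C)^-1.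
Proof.
case=> C3 I4 L5 h7 iC.
have rules := (CC _ _ C3, CVCV _ _ C3, LLL _ _ L5, LVLVLV _ _ L5).
have square z : z * L^-1 * L^-1 * C^-1 * L^-1 * L^-1 * C^-1
                = z * C * L * L * C * L * L.
  have /(congr1 (fun x => z * L^-1 * x * L)) := iV _ _ _ I4 _ _ erefl erefl.
  by rewrite expg2 !gnorm.
split; last first.
  apply: mulg_ext => z; rewrite /thompsonP /thompsonR /A_of_LC /B_of_LC.
  by rewrite !expg2 !gnorm ?rules ?gnorm ?rules ?gnorm.
split; split=> //.
- apply: mulg_ext => z; rewrite /thompsonR /A_of_LC /B_of_LC.
  by rewrite !expg2 !gnorm ?rules ?gnorm.
- apply: mulg_ext => z.
  rewrite /thompsonP /thompsonX2 /thompsonR /A_of_LC /B_of_LC.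
  rewrite !expg2 !gnorm ?rules ?gnorm ?rules ?gnorm.
  by rewrite square ?gnorm ?rules ?gnorm.
- apply: mulg_ext => z.
  by rewrite /thompsonR /A_of_LC /B_of_LC !expg2 !gnorm square.
- by apply/(commute_X2_iff _ _ _ C3 L5 I4).
- by apply/(commute_X3_iff _ _ _ C3 L5 I4).
Qed.

(** The relations R = B^-1 C and C A = R^2 express A and B in R and C, and turn
    R = A^-1 C B into R^4 = 1; then R X_2 = B P becomes (R C)^5 = 1 and
    L = A P A^-1 becomes L = (R C)^2. *)
Lemma thompson_to_LC {G : groupType} (A B C L : G) :
  thompson_relations A B C -> L = A * thompsonP A B C * A^-1 ->
  [/\ LC_relations L C, A = A_of_LC L C & B = B_of_LC L C].
Proof.
case=> [[]] R_B RX2_BP CA_RR [C3 comm2 comm3] L_APA.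
set R := B^-1 * C in R_B.
have BE : B = C * R^-1 by rewrite /R !gnorm.
have AE : A = C^-1 * R * R by rewrite -mulgA -expg2 -R_B -CA_RR mulKg.
have rC := (CC _ _ C3, CVCV _ _ C3).
have R2 z : z * R^-1 * R^-1 = z * R * R.
  apply: (mulIg R^-1); rewrite mulgK -[in RHS]R_B /thompsonR AE BE !gnorm.
  by rewrite rC ?gnorm.
clearbody R.
have L_RC : L = (R * C) ^+ 2.
  apply: mulg_ext => z.
  by rewrite L_APA /thompsonP R_B AE BE expg2 !gnorm R2 !gnorm.
have CRCRC : C * R * C * R * C = R^-1 * C^-1 * R^-1 * C^-1 * R^-1.
  apply: (mulIg R^-1); apply: esym; move: RX2_BP.
  by rewrite /thompsonX2 /thompsonP !R_B AE BE !gnorm rC R2 ?gnorm => <-.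
have RC5 : (R * C) ^+ 5 = 1.
  transitivity (R * C * R * C * R * (C * R * C * R * C)).
    by rewrite !expgS expg0 !gnorm.
  by rewrite CRCRC !gnorm.
have L5 : L ^+ 5 = 1 by rewrite L_RC expgnAC RC5 expg1n.
have LL : L * L = C^-1 * R^-1.
  by rewrite -invgM L_RC -expgnDr; apply/esym/mulg1_eq; rewrite -expgS.
have I4 : (L * C * L) ^+ 4 = 1.
  have conjI : (L * C * L) ^ (L^-1 * C^-1) = R^-1.
    by rewrite conjgE !gnorm -(mulgA C) LL mulVKg.
  apply/(expgJ_eq1 _ _ _ 4 conjI); rewrite !expgS expg0 !gnorm.
  by rewrite R2 !gnorm.
have AL : A = A_of_LC L C.
  by rewrite AE /A_of_LC expg2 LL !gnorm R2.
have BL : B = B_of_LC L C.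
  by rewrite BE /B_of_LC expg2 LL mulgA -{1}(mul1g C^-1) rC mul1g.
rewrite AL BL in comm2 comm3.
have iC : commute ((L * C * L) ^+ 2) C.
  by apply/(commute_X2_iff _ _ _ C3 L5 I4 _ _ erefl erefl).
split=> //; split=> //.
by apply/(commute_X3_iff _ _ _ C3 L5 I4 _ _ _ _ erefl erefl erefl erefl).
Qed.

(** * The presentation *)

Lemma respects_thompson {G : groupType} (a : genABC -> G) :
  respects thompson_rel a <-> thompson_relations (a genA) (a genB) (a genC).
Proof.
split=> [a_rel | [[r1 r2 r3] [r4 r5 r6]] u v []] //.
split; split.
- exact: a_rel thompson_rel1.
- exact: a_rel thompson_rel2.
- exact: a_rel thompson_rel3.
- exact: a_rel thompson_rel4.
- exact: a_rel thompson_rel5.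
- exact: a_rel thompson_rel6.
Qed.

Lemma respects_LC {G : groupType} (b : genLC -> G) :
  respects LC_rel b <-> LC_relations (b genL) (b genC').
Proof.
split=> [b_rel | [r1 r2 r3 r4 r5] u v []] //.
split.
- exact: b_rel LC_rel1.
- exact: b_rel LC_rel2.
- exact: b_rel LC_rel3.
- exact: b_rel LC_rel4.
- exact: b_rel LC_rel5.
Qed.

Definition LC_word (x : genABC) : word genLC :=
  match x with
  | genA => wordL ^+ 2 * wordC * wordL ^+ 2
  | genB => wordC^-1 * wordL ^+ 2
  | genC => wordC
  end.

Definition ABC_word (y : genLC) : word genABC :=
  match y with
  | genL => Gen genA * thompsonP (Gen genA) (Gen genB) (Gen genC)
              * (Gen genA)^-1
  | genC' => Gen genC
  end.

Theorem mainTheorem2 (T : groupType) (A B C : T) (hT : is_ThompsonT A B C)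
    (L : T) (hL : L = A * thompsonP A B C * A^-1) :
  generates (valLC L C) /\ has_presentation (valLC L C) LC_rel.
Proof.
suff presT : has_presentation (valLC L C) LC_rel by split; first case: presT.
apply: (change_presentation thompson_rel LC_rel LC_word ABC_word) hT _.
- move=> G a b /respects_thompson a_rel bE.
  have [b_rel aA aB] := thompson_to_LC _ _ _ _ a_rel (bE genL).
  have bC : b genC' = a genC := bE genC'.
  split; first by apply/respects_LC; rewrite bC.
  by case=> /=; rewrite bC.
- move=> G b a /respects_LC b_rel aE.
  have [a_rel bL] := LC_to_thompson _ _ b_rel.
  have [aA aB aC] : [/\ a genA = A_of_LC (b genL) (b genC'),
    a genB = B_of_LC (b genL) (b genC') & a genC = b genC'].
    by split; [apply: (aE genA) | apply: (aE genB) | apply: (aE genC)].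
  split; first by apply/respects_thompson; rewrite aA aB aC.
  by case=> /=; rewrite ?aA ?aB aC.
- by case.
Qed.
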